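(* Let $\beta\in(\frac{1+\sqrt5}{2},2)$. Then $\widetilde U_\beta$ is a subshift of finite type if and only if the quasi-greedy orbit of $1$ enters the switch region $[\beta^{-1},\beta^{-1}(\beta-1)^{-1}]$ and its first entrance lies in $(\beta^{-1},\beta^{-1}(\beta-1)^{-1}]$; that is, iff there exists $n\ge1$ with $Q^n(1)\in(\beta^{-1},\beta^{-1}(\beta-1)^{-1}]$ and $Q^i(1)\notin[\beta^{-1},\beta^{-1}(\beta-1)^{-1}]$ for $1\le i<n$.
   Context: For $x\in[0,(\beta-1)^{-1}]$, a $\beta$-expansion of $x$ is $(a_n)\in\{0,1\}^{\mathbb{N}}$ with $x=\sum_n a_n\beta^{-n}$. $\widetilde U_\beta\subseteq\{0,1\}^{\mathbb{N}}$ is the set of sequences that are the unique $\beta$-expansion of the number they represent. The greedy expansion of $x$ is produced by the map $G(x)=\beta x\bmod1$ on $[0,1)$, $G(x)=\beta x-1$ on $[1,(\beta-1)^{-1}]$, with digits $\lfloor\beta G^{n-1}(x)\rfloor$. The quasi-greedy expansion $(\eta_i)$ of $1$ equals the greedy expansion of $1$ if that is infinite; if the greedy expansion is $a_1\cdots a_n0^\infty$ with $a_n=1$, then $(\eta_i)=(a_1\cdots a_{n-1}(a_n-1))^\infty$. The quasi-greedy orbit of $1$ is $Q^i(1)=\sum_{j\ge1}\eta_{i+j}\beta^{-j}$, $i\ge1$. A subshift of finite type is a subset of $\{0,1\}^{\mathbb{N}}$ consisting of all sequences avoiding some finite set of forbidden words. *)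

(* Defs.v *)
From Stdlib Require Import Reals Lra Lia ZArith List.
Open Scope R_scope.

(* Sequences in {0,1}^N are functions nat -> bool, indexed from 0:
   a 0 a 1 a 2 ... corresponds to the paper's a_1 a_2 a_3 ... *)
Definition digit (b : bool) : R := if b then 1 else 0.

Definition is_expansion (beta : R) (a : nat -> bool) (x : R) : Prop :=
  infinite_sum (fun n => digit (a n) / beta ^ (S n)) x.

Definition Utilde (beta : R) (a : nat -> bool) : Prop :=
  forall (b : nat -> bool) (x : R),
    is_expansion beta a x -> is_expansion beta b x -> forall n, b n = a n.

Definition occurs_at (w : list bool) (a : nat -> bool) (k : nat) : Prop :=
  forall i, (i < length w)%nat -> nth i w false = a (k + i)%nat.

Definition is_SFT (S : (nat -> bool) -> Prop) : Prop :=
  exists F : list (list bool),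
    forall a, S a <-> (forall w k, In w F -> ~ occurs_at w a k).

Definition G (beta x : R) : R :=
  if Rlt_dec x 1 then beta * x - IZR (Int_part (beta * x)) else beta * x - 1.

Definition Giter (beta : R) (n : nat) (x : R) : R := Nat.iter n (G beta) x.

Definition greedy_digit (beta x : R) (n : nat) : Z :=
  Int_part (beta * Giter beta (n - 1) x).

(* eta (indexed from 1; eta 0 is irrelevant) is the quasi-greedy expansion of 1 *)
Definition quasi_greedy_of_one (beta : R) (eta : nat -> Z) : Prop :=
  ((forall m, (1 <= m)%nat -> Giter beta m 1 <> 0) /\
   (forall i, (1 <= i)%nat -> eta i = greedy_digit beta 1 i))
  \/
  (exists n, (1 <= n)%nat /\ Giter beta n 1 = 0 /\
     (forall m, (1 <= m < n)%nat -> Giter beta m 1 <> 0) /\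
     (forall i, (1 <= i)%nat ->
        let r := ((i - 1) mod n)%nat in
        eta i = if (r + 1 <? n)%nat then greedy_digit beta 1 (r + 1)
                else (greedy_digit beta 1 n - 1)%Z)).

(* y = Q^i(1) = sum_{j>=1} eta_{i+j} beta^{-j} *)
Definition Qorbit (beta : R) (eta : nat -> Z) (i : nat) (y : R) : Prop :=
  infinite_sum (fun j => IZR (eta (i + S j)%nat) / beta ^ (S j)) y.

(* Main.v *)
(* Let [e] be the quasi-greedy expansion of 1.  A sequence lies in [Utilde] iff every
   tail following a 0, and the digitwise complement of every tail following a 1, has
   value below 1; equivalently, is lexicographically below [e].

   If [Q^n(1)] lies in the switch region above [1 / beta], then [e n = true] and
   [Q^(n+1)(1) <= 1 / (beta - 1) - 1], so no sequence of [Utilde] contains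
   0 [e 0 ... e n]: whether a tail is below [e] is decided by its first [n + 1]
   digits, and [Utilde] is determined by its words of length [n + 2].

   Otherwise every [Q^i(1)] exceeds [1 / (beta - 1) - 1], so the complement of every
   tail of [e] is strictly below [e].  Then there are arbitrarily long prefixes of [e]
   within which all these strict inequalities are already decided, and alternating
   such prefixes with complements of such prefixes, each long enough for the previous
   one, gives points of [Utilde] converging to 0 [e], which is not in [Utilde].  So
   [Utilde] is not even closed. *)

Require Import Defs.
From Stdlib Require Import Reals Lra Lia ZArith List Classical ClassicalEpsilon.
From Coquelicot Require Import Coquelicot.
Open Scope R_scope.

(** * Values of the tails of a binary sequence *)

Definition tail_value (beta : R) (a : nat -> bool) (n : nat) : R :=
  Series (fun j => digit (a (n + j)%nat) / beta ^ (S j)).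

Definition flip (a : nat -> bool) : nat -> bool := fun n => negb (a n).

(** Unrolling the recursion, the partial sums miss [x 0] by [x (S k) / beta ^ S k], which vanishes
    for a bounded orbit. Series are evaluated below by exhibiting such an orbit. *)
Lemma series_of_bounded_orbit (beta : R) (d x : nat -> R) (B : R) :
  1 < beta ->
  (forall k, x (S k) = beta * x k - d k) ->
  (forall k, Rabs (x k) <= B) ->
  is_series (fun j => d j / beta ^ (S j)) (x 0%nat).
Proof.
  intros hb hx hB.
  assert (hsum : forall k, sum_f_R0 (fun j => d j / beta ^ (S j)) k
                   = x 0%nat - x (S k) * / beta ^ (S k)).
  { induction k as [|k IH].
    - simpl; rewrite hx; field; lra.
    - rewrite tech5, IH, (hx (S k)).
      assert (beta ^ k <> 0) by (apply pow_nonzero; lra).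
      simpl; field; split; [assumption | lra]. }
  apply is_series_Reals; intros eps heps.
  assert (hB0 : 0 <= B) by (eapply Rle_trans; [apply Rabs_pos | apply (hB 0%nat)]).
  destruct (pow_lt_1_zero (/ beta)) with (y := eps / (B + 1)) as [N hN].
  - rewrite Rabs_pos_eq; [| left; apply Rinv_0_lt_compat; lra].
    rewrite <- Rinv_1; apply Rinv_lt_contravar; lra.
  - apply Rdiv_lt_0_compat; lra.
  - exists N; intros n hn.
    unfold Rdist; rewrite hsum.
    replace (x 0%nat - x (S n) * / beta ^ S n - x 0%nat)
      with (- (x (S n) * (/ beta) ^ S n)) by (rewrite pow_inv; ring).
    rewrite Rabs_Ropp, Rabs_mult.
    specialize (hN (S n) ltac:(lia)).
    apply Rle_lt_trans with (B * Rabs ((/ beta) ^ S n)).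
    + apply Rmult_le_compat_r; [apply Rabs_pos | apply hB].
    + apply Rle_lt_trans with ((B + 1) * Rabs ((/ beta) ^ S n)).
      * apply Rmult_le_compat_r; [apply Rabs_pos | lra].
      * apply Rmult_lt_reg_r with (/ (B + 1)); [apply Rinv_0_lt_compat; lra |].
        replace ((B + 1) * Rabs ((/ beta) ^ S n) * / (B + 1))
          with (Rabs ((/ beta) ^ S n)) by (field; lra).
        exact hN.
Qed.

Lemma tail_value_of_orbit (beta : R) (a : nat -> bool) (x : nat -> R) (B : R) :
  1 < beta ->
  (forall k, x (S k) = beta * x k - digit (a k)) ->
  (forall k, Rabs (x k) <= B) ->
  forall n, tail_value beta a n = x n.
Proof.
  intros hb hx hB n; apply is_series_unique.
  replace (x n) with (x (n + 0)%nat) by (f_equal; lia).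
  apply series_of_bounded_orbit
    with (x := fun k => x (n + k)%nat) (d := fun k => digit (a (n + k)%nat)) (B := B);
    auto.
  intros k; rewrite <- hx; f_equal; lia.
Qed.

Lemma digit_bounds (b : bool) : 0 <= digit b <= 1.
Proof. destruct b; simpl; lra. Qed.

Lemma is_series_inv_pow (beta : R) :
  1 < beta -> is_series (fun j => 1 / beta ^ (S j)) (/ (beta - 1)).
Proof.
  intros hb.
  apply series_of_bounded_orbit
    with (x := fun _ => / (beta - 1)) (d := fun _ => 1) (B := Rabs (/ (beta - 1)));
    intros; try lra.
  field; lra.
Qed.

Lemma digit_term_bounds (beta : R) (b : bool) (j : nat) :
  1 < beta -> 0 <= digit b / beta ^ S j <= 1 / beta ^ S j.
Proof.
  intros hb.
  assert (0 < / beta ^ S j) by (apply Rinv_0_lt_compat, pow_lt; lra).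
  pose proof (digit_bounds b); unfold Rdiv; nra.
Qed.

Lemma ex_series_digits (beta : R) (a : nat -> bool) (n : nat) :
  1 < beta -> ex_series (fun j => digit (a (n + j)%nat) / beta ^ (S j)).
Proof.
  intros hb.
  apply (ex_series_le (K := R_AbsRing) (V := R_CompleteNormedModule) _ (fun j => 1 / beta ^ S j)).
  - intros j; change (Rabs (digit (a (n + j)%nat) / beta ^ S j) <= 1 / beta ^ S j).
    pose proof (digit_term_bounds beta (a (n + j)%nat) j hb).
    rewrite Rabs_pos_eq; lra.
  - exists (/ (beta - 1)); apply is_series_inv_pow; assumption.
Qed.

Lemma is_expansion_tail_value (beta : R) (a : nat -> bool) (x : R) :
  1 < beta -> is_expansion beta a x <-> x = tail_value beta a 0.
Proof.
  intros hb; unfold is_expansion; rewrite <- is_series_Reals; split.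
  - intros h; symmetry; apply is_series_unique, h.
  - intros ->; apply Series_correct, (ex_series_digits beta a 0 hb).
Qed.

Lemma tail_value_bounds (beta : R) (a : nat -> bool) (n : nat) :
  1 < beta -> 0 <= tail_value beta a n <= / (beta - 1).
Proof.
  intros hb; split.
  - rewrite <- (is_series_unique (fun _ => 0) 0).
    + apply Series_le; [| apply ex_series_digits; assumption].
      intros j; split; [lra | apply digit_term_bounds; assumption].
    + apply is_series_Reals; intros eps heps; exists 0%nat; intros k _.
      rewrite sum_cte, Rmult_0_l; unfold Rdist; rewrite Rminus_0_r, Rabs_R0; lra.
  - rewrite <- (is_series_unique _ _ (is_series_inv_pow beta hb)).
    apply Series_le.
    + intros j; apply digit_term_bounds; assumption.
    + exists (/ (beta - 1)); apply is_series_inv_pow; assumption.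
Qed.

Lemma tail_value_step (beta : R) (a : nat -> bool) (n : nat) :
  1 < beta ->
  beta * tail_value beta a n = digit (a n) + tail_value beta a (S n).
Proof.
  intros hb; unfold tail_value.
  rewrite Series_incr_1 by (apply ex_series_digits; assumption).
  rewrite (Series_ext _ (fun k => / beta * (digit (a (S n + k)%nat) / beta ^ S k))).
  - rewrite Series_scal_l, Nat.add_0_r; simpl; field; lra.
  - intros k; replace (n + S k)%nat with (S n + k)%nat by lia.
    assert (beta ^ k <> 0) by (apply pow_nonzero; lra).
    simpl; field; split; [assumption | lra].
Qed.

Lemma tail_value_flip (beta : R) (a : nat -> bool) (n : nat) :
  1 < beta ->
  tail_value beta (flip a) n = / (beta - 1) - tail_value beta a n.
Proof.
  intros hb.
  apply tail_value_of_orbit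
    with (x := fun k => / (beta - 1) - tail_value beta a k) (B := / (beta - 1));
    [assumption | |].
  - intros k; pose proof (tail_value_step beta a k hb).
    assert (beta * / (beta - 1) = 1 + / (beta - 1)) by (field; lra).
    unfold flip; destruct (a k); simpl in *; lra.
  - intros k; pose proof (tail_value_bounds beta a k hb).
    rewrite Rabs_pos_eq; lra.
Qed.

Lemma tail_value_agree (beta : R) (a c : nat -> bool) (n k j : nat) :
  1 < beta ->
  (forall i, (i < j)%nat -> a (n + i)%nat = c (k + i)%nat) ->
  tail_value beta a (n + j) - tail_value beta c (k + j)
  = beta ^ j * (tail_value beta a n - tail_value beta c k).
Proof.
  intros hb; induction j as [|j IH]; intros h.
  - rewrite !Nat.add_0_r; simpl; ring.
  - pose proof (tail_value_step beta a (n + j) hb) as h1.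
    pose proof (tail_value_step beta c (k + j) hb) as h2.
    rewrite (h j) in h1 by lia.
    rewrite !Nat.add_succ_r.
    specialize (IH ltac:(intros; apply h; lia)).
    simpl; rewrite Rmult_assoc, <- IH; lra.
Qed.

(** * Univoque sequences and the switch region *)

Lemma expansion_exists (beta y : R) :
  1 < beta < 2 -> 0 <= y <= / (beta - 1) ->
  exists c, tail_value beta c 0 = y.
Proof.
  intros hb hy.
  (* Greedy digits keep the orbit in [[0, / (beta - 1)]]; after a digit 0 this uses
     [1 < / (beta - 1)]. *)
  set (dig := fun x : R => if Rle_dec 1 (beta * x) then true else false).
  set (x := fun k => Nat.iter k (fun x => beta * x - digit (dig x)) y).
  exists (fun k => dig (x k)).
  assert (hM : beta * / (beta - 1) = 1 + / (beta - 1)) by (field; lra).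
  assert (hM1 : 1 < / (beta - 1)) by (rewrite <- Rinv_1; apply Rinv_lt_contravar; lra).
  apply tail_value_of_orbit with (x := x) (B := / (beta - 1)); [lra | reflexivity |].
  assert (hx : forall k, 0 <= x k <= / (beta - 1)).
  { induction k as [|k IH]; [exact hy |].
    change (x (S k)) with (beta * x k - digit (dig (x k))).
    unfold dig; destruct (Rle_dec 1 (beta * x k)); simpl; nra. }
  intros k; rewrite Rabs_pos_eq; apply hx.
Qed.

(** A value [v] lies in the switch region when [1 <= beta * v <= / (beta - 1)]. The digit at [n]
    makes one of these bounds automatic; the failure of the other is the condition stated, with a
    flip when the digit is 1. *)
Definition tails_off_switch (beta : R) (a : nat -> bool) : Prop :=
  forall n, (a n = false -> tail_value beta a (S n) < 1) /\
            (a n = true -> tail_value beta (flip a) (S n) < 1).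

Lemma tails_off_switch_flip (beta : R) (a : nat -> bool) :
  tails_off_switch beta a -> tails_off_switch beta (flip a).
Proof.
  intros h n; destruct (h n) as [h0 h1]; unfold flip at 1 3; split; intros hn.
  - apply h1; destruct (a n); [reflexivity | discriminate].
  - replace (tail_value beta (flip (flip a)) (S n)) with (tail_value beta a (S n)).
    + apply h0; destruct (a n); [discriminate | reflexivity].
    + apply Series_ext; intros j; unfold flip; rewrite Bool.negb_involutive; reflexivity.
Qed.

(** The bounded quantity is the value needed after position [n] to compensate for changing digit
    [n]. If it has an expansion, splicing that in gives a second expansion of the same number. *)
Lemma Utilde_branching (beta : R) (a : nat -> bool) (n : nat) :
  1 < beta < 2 -> Utilde beta a ->
  0 <= tail_value beta a (S n) + digit (a n) - digit (negb (a n)) <= / (beta - 1) ->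
  False.
Proof.
  intros hb hU hy.
  destruct (expansion_exists beta _ hb hy) as [c hc].
  set (b := fun i => if (i <? n)%nat then a i
                     else if (i =? n)%nat then negb (a n) else c (i - S n)%nat).
  assert (hbn : b n = negb (a n))
    by (unfold b; rewrite Nat.ltb_irrefl, Nat.eqb_refl; reflexivity).
  assert (htail : tail_value beta b (S n) = tail_value beta c 0).
  { apply Series_ext; intros j; unfold b.
    destruct (Nat.ltb_spec (S n + j) n); [lia |].
    destruct (Nat.eqb_spec (S n + j) n); [lia |].
    do 3 f_equal; lia. }
  assert (hn : tail_value beta b n = tail_value beta a n).
  { apply Rmult_eq_reg_l with beta; [| lra].
    rewrite !tail_value_step, htail, hc, hbn by lra; lra. }
  assert (h0 : tail_value beta b 0 = tail_value beta a 0).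
  { assert (hagree := tail_value_agree beta b a 0 0 n ltac:(lra)).
    simpl in hagree; rewrite hn in hagree.
    assert (0 < beta ^ n) by (apply pow_lt; lra).
    apply Rminus_diag_uniq, Rmult_eq_reg_l with (beta ^ n); [| lra].
    rewrite <- hagree; [lra |].
    intros i hi; unfold b; destruct (Nat.ltb_spec i n); [reflexivity | lia]. }
  specialize (hU b (tail_value beta a 0)).
  rewrite !is_expansion_tail_value in hU by lra.
  specialize (hU eq_refl (eq_sym h0) n); rewrite hbn in hU.
  destruct (a n); discriminate.
Qed.

Lemma first_difference (f g : nat -> bool) :
  (exists j, (forall i, (i < j)%nat -> f i = g i) /\ f j = negb (g j))
  \/ (forall i, f i = g i).
Proof.
  destruct (classic (forall i, f i = g i)) as [h|h]; [right; exact h | left].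
  apply not_all_ex_not in h; destruct h as [n hn].
  induction n as [n IH] using lt_wf_ind.
  destruct (classic (exists i, (i < n)%nat /\ f i <> g i)) as [[i [hi hne]]|hmin].
  - exact (IH i hi hne).
  - exists n; split.
    + intros i hi; destruct (Bool.bool_dec (f i) (g i)); [assumption |].
      exfalso; apply hmin; exists i; auto.
    + destruct (f n), (g n); try reflexivity; exfalso; apply hn; reflexivity.
Qed.

Lemma Utilde_tails_off_switch (beta : R) (a : nat -> bool) :
  1 < beta < 2 -> Utilde beta a <-> tails_off_switch beta a.
Proof.
  intros hb.
  assert (hM1 : 1 < / (beta - 1)) by (rewrite <- Rinv_1; apply Rinv_lt_contravar; lra).
  split.
  - intros hU n.
    pose proof (Utilde_branching beta a n hb hU) as hbr.
    pose proof (tail_value_bounds beta a (S n) ltac:(lra)).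
    rewrite tail_value_flip by lra.
    split; intros hn; rewrite hn in hbr; simpl in hbr;
      apply Rnot_le_lt; intros hle; apply hbr; lra.
  - intros h b x.
    rewrite !is_expansion_tail_value by lra; intros -> hx.
    destruct (first_difference b a) as [[j [hj hne]]|]; [exfalso | assumption].
    (* The values at the first difference [j] are still equal, so the tails after [j] differ by
       exactly 1; this pushes the tail of [b] out of [[0, / (beta - 1)]]. *)
    pose proof (tail_value_agree beta b a 0 0 j ltac:(lra) hj) as hagree.
    simpl in hagree; rewrite <- hx, Rminus_diag, Rmult_0_r in hagree.
    pose proof (tail_value_step beta b j ltac:(lra)) as sb.
    pose proof (tail_value_step beta a j ltac:(lra)) as sa.
    pose proof (tail_value_bounds beta b (S j) ltac:(lra)).
    destruct (h j) as [h0 h1]; rewrite tail_value_flip in h1 by lra.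
    rewrite hne in sb; destruct (a j); simpl in *.
    + specialize (h1 eq_refl); nra.
    + specialize (h0 eq_refl); nra.
Qed.

(** * Lexicographic comparison with the quasi-greedy expansion of 1 *)

Definition lex_lt_at (j : nat) (a : nat -> bool) (n : nat) (c : nat -> bool) (k : nat)
  : Prop :=
  (forall i, (i < j)%nat -> a (n + i)%nat = c (k + i)%nat) /\
  a (n + j)%nat = false /\ c (k + j)%nat = true.

Definition lex_lt (a : nat -> bool) (n : nat) (c : nat -> bool) (k : nat) : Prop :=
  exists j, lex_lt_at j a n c k.

Lemma lex_lt_le_trans (a c d : nat -> bool) (n k l : nat) :
  lex_lt a n c k -> ~ lex_lt d l c k -> lex_lt a n d l.
Proof.
  intros [j [hj [haj hcj]]] hcd.
  destruct (first_difference (fun i => c (k + i)%nat) (fun i => d (l + i)%nat))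
    as [[p [hp hne]]|heq].
  - destruct (c (k + p)%nat) eqn:hcp.
    + exfalso; apply hcd; exists p; split; [| split].
      * intros i hi; symmetry; apply hp, hi.
      * destruct (d (l + p)%nat); [discriminate | reflexivity].
      * exact hcp.
    + assert (hdp : d (l + p)%nat = true)
        by (destruct (d (l + p)%nat); [reflexivity | discriminate]).
      destruct (Nat.lt_trichotomy p j) as [hlt|[->|hlt]].
      * exists p; split; [| split]; [| rewrite hj by lia; exact hcp | exact hdp].
        intros i hi; rewrite hj by lia; apply hp; lia.
      * congruence.
      * exists j; split; [| split]; [| exact haj | rewrite <- hp by lia; exact hcj].
        intros i hi; rewrite hj by lia; apply hp; lia.
  - exists j; split; [| split]; [| exact haj | rewrite <- heq; exact hcj].
    intros i hi; rewrite hj by lia; apply heq.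
Qed.

(** The quasi-greedy expansion of 1 described by its orbit: tails of value at most 1 express
    greediness, and positivity rules out an end in zeros. *)
Definition quasi_greedy_bits (beta : R) (e : nat -> bool) : Prop :=
  tail_value beta e 0 = 1 /\ forall i, 0 < tail_value beta e i <= 1.

(** If [a] had the larger digit at the first difference, that digit alone would outweigh the rest of
    [e], whose tails are at most 1, and the value of [a] would reach 1. *)
Lemma lex_lt_of_tail_value_lt_1 (beta : R) (e a : nat -> bool) (n : nat) :
  1 < beta -> quasi_greedy_bits beta e ->
  tail_value beta a n < 1 -> lex_lt a n e 0.
Proof.
  intros hb [he0 he] hlt.
  destruct (first_difference (fun i => a (n + i)%nat) e) as [[j [hj hne]]|heq].
  - exists j; split; [exact hj |]; simpl.
    destruct (e j) eqn:hej; [auto | exfalso].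
    pose proof (tail_value_agree beta a e n 0 j hb hj) as hagree; simpl in hagree.
    pose proof (tail_value_step beta a (n + j) hb) as sa.
    pose proof (tail_value_step beta e j hb) as se.
    rewrite hne in sa; rewrite hej in se; simpl in sa, se.
    pose proof (tail_value_bounds beta a (S (n + j)) hb).
    pose proof (he (S j)).
    assert (0 < beta ^ j) by (apply pow_lt; lra).
    assert (tail_value beta e j <= tail_value beta a (n + j)) by nra.
    rewrite he0 in hagree; nra.
  - exfalso.
    assert (tail_value beta a n = tail_value beta e 0)
      by (apply Series_ext; intros j; simpl; rewrite heq; reflexivity).
    lra.
Qed.

Lemma tail_value_lt_1_of_lex_lt (beta : R) (e a : nat -> bool) :
  1 < beta -> quasi_greedy_bits beta e ->
  (forall n, a n = false -> lex_lt a (S n) e 0) ->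
  forall n, a n = false -> tail_value beta a (S n) < 1.
Proof.
  intros hb [he0 he] hlex n hn.
  set (v := fun n => tail_value beta a (S n) - 1).
  (* At the first difference with [e] the excess [v] is expanded by a factor at
     least [beta] and then increased, so it can never have been nonnegative. *)
  assert (hstep : forall n, a n = false -> 0 <= v n ->
            exists n', a n' = false /\ 0 < v n' /\ beta * v n <= v n').
  { clear n hn; intros n hn hv.
    destruct (hlex n hn) as [j [hj [haj hej]]]; simpl in hej.
    exists (S n + j)%nat; split; [exact haj |].
    pose proof (tail_value_agree beta a e (S n) 0 j hb hj) as hagree.
    pose proof (tail_value_step beta a (S n + j) hb) as sa.
    pose proof (tail_value_step beta e j hb) as se.
    rewrite haj in sa; rewrite hej in se; unfold digit in sa, se.
    rewrite he0 in hagree; simpl (0 + j)%nat in hagree.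
    pose proof (he (S j)).
    assert (1 <= beta ^ j) by (apply pow_R1_Rle; lra).
    unfold v in *.
    assert (hval : tail_value beta a (S (S n + j)) - 1
             = beta * (beta ^ j * (tail_value beta a (S n) - 1)) + tail_value beta e (S j))
      by (rewrite <- hagree; lra).
    rewrite hval.
    assert (tail_value beta a (S n) - 1 <= beta ^ j * (tail_value beta a (S n) - 1)) by nra.
    split; nra. }
  (* One step makes the excess positive even if it starts at 0; from then on it grows geometrically,
     against the uniform bound on tail values. *)
  apply Rnot_le_lt; intros hle.
  destruct (hstep n hn ltac:(unfold v; lra)) as [n0 [hn0 [hv0 _]]].
  assert (hgrow : forall k, exists n', a n' = false /\ beta ^ k * v n0 <= v n').
  { induction k as [|k [n' [hn' hv']]].
    - exists n0; split; [assumption | simpl; lra].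
    - assert (0 < beta ^ k) by (apply pow_lt; lra).
      destruct (hstep n' hn' ltac:(nra)) as [n'' [hn'' [_ hv'']]].
      exists n''; split; [assumption | simpl; nra]. }
  destruct (Pow_x_infinity beta ltac:(rewrite Rabs_pos_eq; lra) (/ (beta - 1) / v n0))
    as [N hN].
  specialize (hN N (le_n N)).
  rewrite Rabs_pos_eq in hN by (apply pow_le; lra).
  destruct (hgrow N) as [n' [_ hv']].
  pose proof (tail_value_bounds beta a (S n') hb).
  assert (/ (beta - 1) <= beta ^ N * v n0).
  { apply Rle_trans with (/ (beta - 1) / v n0 * v n0).
    - right; field; split; lra.
    - apply Rmult_le_compat_r; lra. }
  unfold v in *; lra.
Qed.

Lemma tails_off_switch_of_lex (beta : R) (e a : nat -> bool) :
  1 < beta -> quasi_greedy_bits beta e ->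
  (forall n, a n = false -> lex_lt a (S n) e 0) ->
  (forall n, a n = true -> lex_lt (flip a) (S n) e 0) ->
  tails_off_switch beta a.
Proof.
  intros hb he h0 h1 n; split; intros hn.
  - apply tail_value_lt_1_of_lex_lt with e; assumption.
  - apply tail_value_lt_1_of_lex_lt with e; try assumption.
    + intros k hk; apply h1; unfold flip in hk; destruct (a k); [reflexivity | discriminate].
    + unfold flip; rewrite hn; reflexivity.
Qed.

(** A shift lexicographically above [e] would have value above 1, strictly because the tail
    following its larger digit is positive. *)
Lemma quasi_greedy_bits_shift_le (beta : R) (e : nat -> bool) (i : nat) :
  1 < beta -> quasi_greedy_bits beta e -> ~ lex_lt e 0 e i.
Proof.
  intros hb [he0 he] [j [hj [h0 h1]]].
  pose proof (tail_value_agree beta e e 0 i j hb hj) as hagree; simpl in hagree, h0.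
  pose proof (tail_value_step beta e j hb) as s0.
  pose proof (tail_value_step beta e (i + j) hb) as s1.
  rewrite h0 in s0; rewrite h1 in s1; simpl in s0, s1.
  pose proof (he (S j)); pose proof (he (S (i + j))); pose proof (he i).
  assert (0 < beta ^ j) by (apply pow_lt; lra).
  assert (tail_value beta e j < tail_value beta e (i + j)) by nra.
  rewrite he0 in hagree; nra.
Qed.

(** * Finite type from windows of bounded length *)

Lemma ex_sublist {A : Type} (l : list A) (P : A -> Prop) :
  exists F, forall w, In w F <-> In w l /\ P w.
Proof.
  induction l as [|x l [F hF]].
  - exists nil; simpl; tauto.
  - destruct (classic (P x)) as [hx|hx].
    + exists (x :: F); intros w; simpl; rewrite hF; split; [| tauto].
      intros [->|]; tauto.
    + exists F; intros w; simpl; rewrite hF; split; [tauto |].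
      intros [[->|] ?]; tauto.
Qed.

Lemma ex_list_words (n : nat) :
  exists l : list (list bool), forall w, length w = n -> In w l.
Proof.
  induction n as [|n [l hl]].
  - exists (nil :: nil); intros [|]; simpl; [auto | discriminate].
  - exists (map (cons true) l ++ map (cons false) l).
    intros [|x w] hw; [discriminate |]; simpl in hw; injection hw as hw.
    apply in_or_app; destruct x; [left | right]; apply in_map, hl, hw.
Qed.

(** The forbidden words are the words of length [N] that occur in no member of [S]. *)
Lemma is_SFT_of_windows (S : (nat -> bool) -> Prop) (N : nat) :
  (forall a, (forall n, exists b k, S b /\
      forall i, (i < N)%nat -> b (k + i)%nat = a (n + i)%nat) -> S a) ->
  is_SFT S.
Proof.
  intros hS.
  destruct (ex_list_words N) as [l hl].
  destruct (ex_sublist l (fun w => forall b k, S b -> ~ occurs_at w b k)) as [F hF].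
  exists F; intros a; split.
  - intros ha w k hw; apply hF in hw; apply hw, ha.
  - intros ha; apply hS; intros n.
    set (w := map a (seq n N)).
    assert (hlen : length w = N) by (unfold w; rewrite length_map, length_seq; reflexivity).
    assert (hw : forall i, (i < N)%nat -> nth i w false = a (n + i)%nat).
    (* The default becomes an image under [a], as [map_nth] requires. *)
    { intros i hi; rewrite (nth_indep w false (a 0%nat)) by lia.
      unfold w; rewrite map_nth, seq_nth by lia; reflexivity. }
    apply NNPP; intros hno.
    apply (ha w n); [| intros i hi; apply hw; lia].
    apply hF; split; [apply hl, hlen |].
    intros b k hb hocc; apply hno; exists b, k; split; [assumption |].
    intros i hi; rewrite <- hw by lia; symmetry; apply hocc; lia.
Qed.

(* The word [e 0 ... e n] cannot follow a 0 in a sequence [b] of the univoque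
   set: it ends in 1, so the next tail of [b] would exceed
   [1 / (beta - 1) - 1 >= tail_value beta e (S n)], pushing the value past 1. *)
Lemma lex_lt_before_low_tail (beta : R) (e b : nat -> bool) (n k : nat) :
  1 < beta -> quasi_greedy_bits beta e ->
  e n = true -> tail_value beta e (S n) <= / (beta - 1) - 1 ->
  tails_off_switch beta b -> b k = false ->
  exists j, (j <= n)%nat /\ lex_lt_at j b (S k) e 0.
Proof.
  intros hb he hn hlow hoff hk.
  destruct (hoff k) as [h _]; specialize (h hk).
  destruct (lex_lt_of_tail_value_lt_1 beta e b (S k) hb he h) as [j hj].
  destruct (le_lt_dec j n) as [hjn|hjn]; [exists j; auto | exfalso].
  destruct hj as [hj _].
  pose proof (tail_value_agree beta b e (S k) 0 (S n) hb
                ltac:(intros; apply hj; lia)) as hagree.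
  assert (hbn : b (S k + n)%nat = true) by (rewrite hj by lia; exact hn).
  destruct (hoff (S k + n)%nat) as [_ h1]; specialize (h1 hbn).
  rewrite tail_value_flip in h1 by assumption.
  replace (S k + S n)%nat with (S (S k + n)) in hagree by lia.
  simpl (0 + S n)%nat in hagree.
  destruct he as [he0 _]; rewrite he0 in hagree.
  assert (0 < beta ^ S n) by (apply pow_lt; lra).
  nra.
Qed.

Lemma is_SFT_Utilde (beta : R) (e : nat -> bool) (n : nat) :
  1 < beta < 2 -> quasi_greedy_bits beta e ->
  e n = true -> tail_value beta e (S n) <= / (beta - 1) - 1 ->
  is_SFT (Utilde beta).
Proof.
  intros hb he hn hlow.
  apply is_SFT_of_windows with (N := S (S n)).
  intros a hwin; apply Utilde_tails_off_switch; [assumption |].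
  (* The comparison for [b] is decided inside the window, hence carries over to [c]; it is applied
     to [a] and to [flip a]. *)
  assert (hlex : forall (c : nat -> bool) p b k, tails_off_switch beta b ->
            (forall i, (i < S (S n))%nat -> b (k + i)%nat = c (p + i)%nat) ->
            c p = false -> lex_lt c (S p) e 0).
  { intros c p b k hoff hag hc.
    assert (hbk : b k = false)
      by (specialize (hag 0%nat ltac:(lia)); rewrite !Nat.add_0_r in hag; congruence).
    destruct (lex_lt_before_low_tail beta e b n k ltac:(lra) he hn hlow hoff hbk)
      as [j [hjn [hj [h0 h1]]]].
    assert (hcb : forall i, (i <= j)%nat -> c (S p + i)%nat = b (S k + i)%nat).
    { intros i hi; specialize (hag (S i) ltac:(lia)).
      rewrite !Nat.add_succ_r in hag; symmetry; exact hag. }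
    exists j; split; [| split].
    - intros i hi; rewrite hcb by lia; apply hj, hi.
    - rewrite hcb by lia; exact h0.
    - exact h1. }
  apply tails_off_switch_of_lex with e; [lra | assumption | |]; intros p hp;
    destruct (hwin p) as [b [k [hbU hag]]];
    apply Utilde_tails_off_switch in hbU; try assumption.
  - apply (hlex a p b k); assumption.
  - apply (hlex (flip a) p (flip b) k).
    + apply tails_off_switch_flip; assumption.
    + intros i hi; unfold flip; rewrite hag by assumption; reflexivity.
    + unfold flip; rewrite hp; reflexivity.
Qed.

(** * Alternating blocks and the failure of finite type *)

Definition decided_prefix (e : nat -> bool) (m : nat) : Prop :=
  forall i, (i < m)%nat -> exists j, (i + j < m)%nat /\ lex_lt_at j (flip e) i e 0.

(** If length [S N] leaves positions undecided, extend the prefix just until the least of them, [k],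
    is decided, at [k + j]. A position [i > k] still undecided there would put the shift of [e] by
    [i - k] above [e]. *)
Lemma decided_prefix_unbounded (e : nat -> bool) (N : nat) :
  (forall i, ~ lex_lt e 0 e i) ->
  (forall i, lex_lt (flip e) i e 0) ->
  exists m, (N < m)%nat /\ decided_prefix e m.
Proof.
  intros hmax hflip.
  set (undecided := fun i => (i < S N)%nat /\
         ~ exists j, (i + j < S N)%nat /\ lex_lt_at j (flip e) i e 0).
  destruct (classic (exists i, undecided i)) as [hex|hno].
  - destruct (dec_inh_nat_subset_has_unique_least_element undecided
                (fun i => classic _) hex) as [k [[[hk hkj] hmin] _]].
    destruct (hflip k) as [j hj].
    exists (S (k + j)).
    assert (hkj' : (S N <= k + j)%nat).
    { destruct (le_lt_dec (S N) (k + j)); [assumption |].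
      exfalso; apply hkj; exists j; auto. }
    split; [lia |].
    intros i hi.
    destruct (hflip i) as [l hl].
    destruct (le_lt_dec (S (k + j)) (i + l)) as [hil|hil]; [exfalso | exists l; auto].
    destruct hj as [hj [hj0 hj1]], hl as [hl [hl0 hl1]]; simpl in hj, hj1, hl, hl1.
    destruct (Nat.lt_trichotomy i k) as [hik|[->|hik]].
    + assert (hui : ~ undecided i) by (intros hu; apply hmin in hu; lia).
      apply hui; split; [lia |].
      intros [l' [hl' [hp [hp0 hp1]]]]; simpl in hp, hp1.
      rewrite (hl l') in hp0 by lia; congruence.
    + rewrite (hl j) in hj0 by lia; congruence.
    + apply (hmax (i - k)%nat); exists (k + j - i)%nat; split; [| split]; simpl.
      * intros p hp.
        rewrite <- (hl p) by lia; rewrite <- (hj (i - k + p)%nat) by lia.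
        f_equal; lia.
      * rewrite <- (hl (k + j - i)%nat) by lia.
        rewrite <- hj0; f_equal; lia.
      * rewrite <- hj1; f_equal; lia.
  - exists (S N); split; [lia |].
    intros i hi; apply NNPP; intros hu; apply hno; exists i; split; assumption.
Qed.

(* A state [(b, p, m)] means: position [p] in a block [e 0 ... e (m - 1)], which is
   written flipped when [b] is [true]; after it comes a block of length [f m] with
   the other sign. *)
Definition block_step (f : nat -> nat) (s : bool * nat * nat) : bool * nat * nat :=
  let '(b, p, m) := s in
  if (S p <? m)%nat then (b, S p, m) else (negb b, 0%nat, f m).

Definition block_state (f : nat -> nat) (m0 n : nat) : bool * nat * nat :=
  Nat.iter n (block_step f) (false, 0%nat, m0).

Definition block_seq (e : nat -> bool) (f : nat -> nat) (m0 n : nat) : bool :=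
  let '(b, p, _) := block_state f m0 n in xorb b (e p).

Lemma block_state_run (f : nat -> nat) (m0 n : nat) (b : bool) (p m l : nat) :
  block_state f m0 n = (b, p, m) -> (p + l < m)%nat ->
  block_state f m0 (n + l) = (b, (p + l)%nat, m).
Proof.
  intros hs; induction l as [|l IH]; intros hl.
  - rewrite !Nat.add_0_r; exact hs.
  - rewrite Nat.add_succ_r.
    change (block_step f (block_state f m0 (n + l)) = (b, (p + S l)%nat, m)).
    rewrite IH by lia; simpl.
    destruct (Nat.ltb_spec (S (p + l)) m); [| lia].
    rewrite Nat.add_succ_r; reflexivity.
Qed.

Lemma block_state_next (f : nat -> nat) (m0 n : nat) (b : bool) (p m : nat) :
  block_state f m0 n = (b, p, m) -> (p < m)%nat ->
  block_state f m0 (n + (m - p)) = (negb b, 0%nat, f m).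
Proof.
  intros hs hp.
  replace (n + (m - p))%nat with (S (n + (m - S p))) by lia.
  change (block_step f (block_state f m0 (n + (m - S p))) = (negb b, 0%nat, f m)).
  rewrite (block_state_run f m0 n b p m) by (assumption || lia); simpl.
  destruct (Nat.ltb_spec (S (p + (m - S p))) m); [lia | reflexivity].
Qed.

(** The second clause says that [e 0 ... e (m - 1)] followed by the flipped prefix of length [m']
    falls below [e] before that prefix ends. *)
Definition admissible_next (e : nat -> bool) (m m' : nat) : Prop :=
  decided_prefix e m' /\
  exists j, (j < m')%nat /\ lex_lt_at j (flip e) m e 0.

Lemma block_state_invariant (e : nat -> bool) (f : nat -> nat) (m0 n : nat) :
  (0 < m0)%nat -> decided_prefix e m0 -> (forall m, admissible_next e m (f m)) ->
  let '(_, p, m) := block_state f m0 n in (p < m)%nat /\ decided_prefix e m.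
Proof.
  intros hm0 hdec hf; induction n as [|n IH]; [simpl; auto |].
  change (block_state f m0 (S n)) with (block_step f (block_state f m0 n)).
  destruct (block_state f m0 n) as [[b p] m]; simpl.
  destruct (Nat.ltb_spec (S p) m); [tauto |].
  destruct (hf m) as [hd [j [hj _]]]; split; [lia | exact hd].
Qed.

Lemma lex_lt_ext (a a' c : nat -> bool) (n n' k : nat) :
  (forall i, a' (n' + i)%nat = a (n + i)%nat) ->
  lex_lt a n c k -> lex_lt a' n' c k.
Proof.
  intros h [j [hj [h0 h1]]]; exists j; split; [| split]; [| rewrite h; exact h0 | exact h1].
  intros i hi; rewrite h; apply hj, hi.
Qed.

(** Undo the sign of the current block. The sequence follows [e] from [p] to the block's end and
    drops below it in the next block, while that shift of [e] is at most [e]. Its complement is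
    already below [e] within the current block, a decided prefix. A flipped block swaps the two
    claims. *)
Lemma block_seq_lex_lt (e : nat -> bool) (f : nat -> nat) (m0 n : nat) :
  (forall i, ~ lex_lt e 0 e i) ->
  (0 < m0)%nat -> decided_prefix e m0 -> (forall m, admissible_next e m (f m)) ->
  lex_lt (block_seq e f m0) n e 0 /\ lex_lt (flip (block_seq e f m0)) n e 0.
Proof.
  intros hmax hm0 hdec hf.
  pose proof (block_state_invariant e f m0 n hm0 hdec hf) as hinv.
  destruct (block_state f m0 n) as [[b p] m] eqn:hs; destruct hinv as [hp hm].
  set (c := block_seq e f m0).
  assert (hcur : forall i, (p + i < m)%nat -> c (n + i)%nat = xorb b (e (p + i)%nat)).
  { intros i hi; unfold c, block_seq.
    rewrite (block_state_run f m0 n b p m) by assumption; reflexivity. }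
  assert (hnext : forall i, (i < f m)%nat ->
            c (n + (m - p) + i)%nat = xorb (negb b) (e i)).
  { intros i hi; unfold c, block_seq.
    rewrite (block_state_run f m0 _ (negb b) 0 (f m));
      [reflexivity | apply block_state_next; assumption | assumption]. }
  assert (hupper : lex_lt (fun i => xorb b (c i)) n e 0).
  { apply lex_lt_le_trans with (c := e) (k := p); [| apply hmax].
    destruct (hf m) as [_ [j [hjm [hj [h0 h1]]]]]; unfold flip in hj, h0.
    exists (m - p + j)%nat; split; [| split].
    - intros i hi; destruct (le_lt_dec m (p + i)) as [hle|hlt].
      + replace (n + i)%nat with (n + (m - p) + (p + i - m))%nat by lia.
        rewrite hnext by lia.
        specialize (hj (p + i - m)%nat ltac:(lia)); simpl in hj.
        rewrite <- hj; replace (m + (p + i - m))%nat with (p + i)%nat by lia.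
        destruct b, (e (p + i)%nat); reflexivity.
      + rewrite hcur by assumption; destruct b, (e (p + i)%nat); reflexivity.
    - rewrite Nat.add_assoc, hnext by assumption; simpl in h1; rewrite h1.
      destruct b; reflexivity.
    - replace (p + (m - p + j))%nat with (m + j)%nat by lia.
      destruct (e (m + j)%nat); [reflexivity | discriminate]. }
  assert (hlower : lex_lt (fun i => negb (xorb b (c i))) n e 0).
  { destruct (hm p hp) as [j [hjm [hj [h0 h1]]]]; unfold flip in hj, h0.
    exists j; split; [| split]; [| | exact h1].
    - intros i hi; rewrite hcur, <- hj by lia; destruct b, (e (p + i)%nat); reflexivity.
    - rewrite hcur by assumption; destruct b, (e (p + j)%nat); auto. }
  destruct b; split;
    [revert hlower | revert hupper | revert hupper | revert hlower];
    apply lex_lt_ext; intros i; unfold flip; destruct (c (n + i)%nat); reflexivity.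
Qed.

Definition cons_false (a : nat -> bool) (n : nat) : bool :=
  match n with O => false | S n => a n end.

Lemma not_is_SFT_Utilde (beta : R) (e : nat -> bool) :
  1 < beta < 2 -> quasi_greedy_bits beta e ->
  (forall i, / (beta - 1) - 1 < tail_value beta e i) ->
  ~ is_SFT (Utilde beta).
Proof.
  intros hb he hhigh [F hF].
  assert (hb1 : 1 < beta) by lra.
  assert (hmax : forall i, ~ lex_lt e 0 e i)
    by (intros i; apply quasi_greedy_bits_shift_le with beta; assumption).
  assert (hflip : forall i, lex_lt (flip e) i e 0).
  { intros i; apply lex_lt_of_tail_value_lt_1 with beta; try assumption.
    rewrite tail_value_flip by assumption; specialize (hhigh i); lra. }
  assert (hnot : ~ Utilde beta (cons_false e)).
  { rewrite Utilde_tails_off_switch by assumption; intros h.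
    destruct (h 0%nat) as [h0 _]; specialize (h0 eq_refl).
    change (tail_value beta (cons_false e) 1) with (tail_value beta e 0) in h0.
    destruct he; lra. }
  apply hnot, hF; intros w k hw hocc.
  (* A first block longer than [k + length w] places the forbidden word in a member of [Utilde] as
     well. *)
  destruct (decided_prefix_unbounded e (k + length w) hmax hflip) as [m0 [hm0 hdec]].
  assert (hnext : forall m, exists m', admissible_next e m m').
  { intros m; destruct (hflip m) as [j hj].
    destruct (decided_prefix_unbounded e j hmax hflip) as [m' [hm' hd]].
    exists m'; split; [exact hd | exists j; auto]. }
  set (f := fun m => proj1_sig (constructive_indefinite_description _ (hnext m))).
  assert (hf : forall m, admissible_next e m (f m))
    by (intros m; apply (proj2_sig (constructive_indefinite_description _ (hnext m)))).
  set (a := cons_false (block_seq e f m0)).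
  assert (ha : Utilde beta a).
  { apply Utilde_tails_off_switch; [assumption |].
    apply tails_off_switch_of_lex with e; try assumption; intros n _;
      destruct (block_seq_lex_lt e f m0 n hmax ltac:(lia) hdec hf) as [h0 h1];
      [exact h0 | exact h1]. }
  apply (proj1 (hF a) ha w k hw).
  intros i hi; rewrite hocc by assumption.
  unfold a, cons_false; destruct (k + i)%nat as [|q] eqn:hq; [reflexivity |].
  unfold block_seq.
  assert (hrun : block_state f m0 q = (false, q, m0))
    by (apply (block_state_run f m0 0 false 0 m0 q); [reflexivity | lia]).
  rewrite hrun; reflexivity.
Qed.

(** * From the greedy map to the quasi-greedy digits *)

Lemma Giter_bounds (beta : R) (n : nat) :
  1 < beta < 2 -> 0 <= Giter beta (S n) 1 < 1.
Proof.
  intros hb; induction n as [|n IH].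
  - unfold Giter; simpl; unfold G; destruct (Rlt_dec 1 1); lra.
  - change (0 <= G beta (Giter beta (S n) 1) < 1); unfold G.
    destruct (Rlt_dec (Giter beta (S n) 1) 1); [| lra].
    pose proof (base_Int_part (beta * Giter beta (S n) 1)); lra.
Qed.

Lemma Giter_step (beta : R) (n : nat) :
  1 < beta < 2 ->
  Giter beta (S n) 1 = beta * Giter beta n 1 - IZR (greedy_digit beta 1 (S n)).
Proof.
  intros hb; unfold greedy_digit; simpl (S n - 1)%nat; rewrite Nat.sub_0_r.
  change (Giter beta (S n) 1) with (G beta (Giter beta n 1)); unfold G.
  destruct (Rlt_dec (Giter beta n 1) 1) as [|hge]; [reflexivity |].
  (* Only the starting point 1 uses the second branch of [G], and there the integer part of [beta]
     is 1. *)
  destruct n as [|n]; [| pose proof (Giter_bounds beta n hb); lra].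
  rewrite <- (Int_part_spec (beta * Giter beta 0 1) 1); unfold Giter; simpl; lra.
Qed.

(** In the infinite case the orbit is the greedy one. In the finite case, lowering the last digit by
    1 sends the point to 1 instead of 0, so the greedy orbit is repeated with period [n]. *)
Lemma quasi_greedy_orbit (beta : R) (eta : nat -> Z) :
  1 < beta < 2 -> quasi_greedy_of_one beta eta ->
  exists q : nat -> R, q 0%nat = 1 /\ (forall i, 0 < q i <= 1) /\
    forall i, q (S i) = beta * q i - IZR (eta (S i)).
Proof.
  intros hb [[hne heta]|[n [hn1 [hn0 [hne heta]]]]].
  - exists (fun i => Giter beta i 1); split; [reflexivity | split].
    + intros [|i]; [unfold Giter; simpl; lra |].
      pose proof (Giter_bounds beta i hb).
      specialize (hne (S i) ltac:(lia)); lra.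
    + intros i; rewrite heta by lia; apply Giter_step; assumption.
  - exists (fun i => Giter beta (i mod n) 1); split; [| split].
    + rewrite Nat.Div0.mod_0_l; reflexivity.
    + intros i; pose proof (Nat.mod_upper_bound i n ltac:(lia)).
      destruct (i mod n)%nat as [|r]; [unfold Giter; simpl; lra |].
      pose proof (Giter_bounds beta r hb).
      specialize (hne (S r) ltac:(lia)); lra.
    + intros i; rewrite heta by lia; simpl (S i - 1)%nat; rewrite Nat.sub_0_r; cbv zeta.
      pose proof (Nat.mod_upper_bound i n ltac:(lia)) as hr.
      pose proof (Nat.div_mod_eq i n) as hdm.
      set (r := (i mod n)%nat) in *.
      rewrite Nat.add_1_r; destruct (Nat.ltb_spec (S r) n) as [hlt|hge].
      * rewrite <- (Nat.mod_unique (S i) n (i / n) (S r)) by lia.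
        apply Giter_step; assumption.
      * replace n with (S r) in * by lia.
        rewrite <- (Nat.mod_unique (S i) (S r) (S (i / S r)) 0) by lia.
        rewrite minus_IZR.
        rewrite Giter_step in hn0 by assumption.
        unfold Giter at 1; simpl (Nat.iter 0 _ _); lra.
Qed.

Lemma quasi_greedy_bits_of_one (beta : R) (eta : nat -> Z) :
  1 < beta < 2 -> quasi_greedy_of_one beta eta ->
  exists e, quasi_greedy_bits beta e /\
    forall i y, Qorbit beta eta i y <-> y = tail_value beta e i.
Proof.
  intros hb hq; destruct (quasi_greedy_orbit beta eta hb hq) as [q [q0 [hpos hstep]]].
  (* The index shift turns [Q^i(1)] into [tail_value beta e i]. *)
  set (e := fun i => Z.eqb (eta (S i)) 1).
  assert (hdig : forall i, IZR (eta (S i)) = digit (e i)).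
  { intros i; unfold e.
    pose proof (hpos i); pose proof (hpos (S i)); pose proof (hstep i).
    assert (-1 < eta (S i) < 2)%Z by (split; apply lt_IZR; simpl; nra).
    assert (hz : eta (S i) = 0%Z \/ eta (S i) = 1%Z) by lia.
    destruct hz as [-> | ->]; reflexivity. }
  assert (hT : forall n, tail_value beta e n = q n).
  { apply tail_value_of_orbit with (B := 1); [lra | |].
    - intros k; rewrite hstep, hdig; reflexivity.
    - intros k; pose proof (hpos k); rewrite Rabs_pos_eq; lra. }
  exists e; split; [split; intros; rewrite hT; auto |].
  intros i y; unfold Qorbit; rewrite <- is_series_Reals.
  assert (hs : is_series (fun j => IZR (eta (i + S j)%nat) / beta ^ S j)
                 (tail_value beta e i)).
  { apply is_series_ext with (fun j => digit (e (i + j)%nat) / beta ^ S j).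
    - intros j; rewrite Nat.add_succ_r, hdig; reflexivity.
    - apply Series_correct, ex_series_digits; lra. }
  split; [| intros ->; exact hs].
  intros hy; rewrite <- (is_series_unique _ _ hy); apply is_series_unique, hs.
Qed.

(** * Entrances of the quasi-greedy orbit into the switch region *)

Lemma quasi_greedy_bit_iff (beta : R) (e : nat -> bool) (i : nat) :
  1 < beta -> quasi_greedy_bits beta e ->
  e i = true <-> / beta < tail_value beta e i.
Proof.
  intros hb [_ he].
  pose proof (tail_value_step beta e i hb) as hs.
  pose proof (he (S i)).
  assert (beta * / beta = 1) by (field; lra).
  (* The tail after a 1 is positive and the tail after a 0 is at most 1, so the point [/ beta]
     itself carries digit 0. *)
  destruct (e i); simpl in hs; split; try discriminate; try reflexivity; intros; nra.
Qed.

(** The value determines the digit, and with it the next value. *)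
Lemma quasi_greedy_bits_return (beta : R) (e : nat -> bool) (n i : nat) :
  1 < beta -> quasi_greedy_bits beta e ->
  tail_value beta e n = 1 -> tail_value beta e (n + i) = tail_value beta e i.
Proof.
  intros hb he hn; induction i as [|i IH].
  - rewrite Nat.add_0_r, hn; symmetry; apply he.
  - rewrite Nat.add_succ_r.
    assert (hbit : e (n + i)%nat = e i).
    { apply Bool.eq_iff_eq_true.
      rewrite !(quasi_greedy_bit_iff beta) by assumption; rewrite IH; reflexivity. }
    pose proof (tail_value_step beta e (n + i) hb) as h1.
    pose proof (tail_value_step beta e i hb) as h2.
    rewrite hbit, IH in h1; lra.
Qed.

(* If the first entrance were at [/ beta], the orbit would return to 1 right after
   it and be periodic, so it could not meet the rest of the switch region later. *)
Lemma first_entrance (beta s : R) (e : nat -> bool) (k : nat) :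
  1 < beta -> quasi_greedy_bits beta e -> s < 1 ->
  (1 <= k)%nat -> / beta < tail_value beta e k <= s ->
  exists n, (1 <= n)%nat /\ / beta < tail_value beta e n <= s /\
    forall i, (1 <= i < n)%nat -> ~ (/ beta <= tail_value beta e i <= s).
Proof.
  intros hb he hs.
  induction k as [k IH] using lt_wf_ind; intros hk1 hk.
  destruct (classic (exists i, (1 <= i < k)%nat /\ / beta <= tail_value beta e i <= s))
    as [[i [hik [[hi|hi] his]]]|hno].
  - apply (IH i); [lia | lia | lra].
  - assert (hret : tail_value beta e (S i) = 1).
    { pose proof (tail_value_step beta e i hb) as hst.
      rewrite <- hi, Rinv_r in hst by lra.
      assert (hei : e i = false).
      { destruct (e i) eqn:hei; [| reflexivity].
        apply (quasi_greedy_bit_iff beta) in hei; try assumption; lra. }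
      rewrite hei in hst; simpl in hst; lra. }
    pose proof (quasi_greedy_bits_return beta e (S i) (k - S i) hb he hret) as hper.
    replace (S i + (k - S i))%nat with k in hper by lia.
    (* At [S i] the value is [1 > s]; otherwise periodicity moves the entrance back to [k - S i]. *)
    destruct (Nat.eq_dec k (S i)) as [->|hne]; [lra |].
    apply (IH (k - S i)%nat); [lia | lia | lra].
  - exists k; split; [assumption | split; [assumption |]].
    intros i hi hreg; apply hno; exists i; auto.
Qed.

Theorem theorem3p7 (beta : R) (eta : nat -> Z)
  (hbeta : (1 + sqrt 5) / 2 < beta < 2)
  (heta : quasi_greedy_of_one beta eta) :
  is_SFT (Utilde beta) <->
  exists n : nat, (1 <= n)%nat /\
    (exists y, Qorbit beta eta n y /\
       / beta < y <= / beta * / (beta - 1)) /\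
    (forall i : nat, (1 <= i < n)%nat ->
       forall y, Qorbit beta eta i y ->
         ~ (/ beta <= y <= / beta * / (beta - 1))).
Proof.
  assert (hsqrt : sqrt 5 * sqrt 5 = 5) by (apply sqrt_sqrt; lra).
  assert (hsqrt0 : 0 <= sqrt 5) by apply sqrt_pos.
  (* This form of the golden mean bound places the switch region below 1. *)
  assert (hgold : 1 < beta * (beta - 1)) by nra.
  assert (hb : 1 < beta < 2) by nra.
  destruct (quasi_greedy_bits_of_one beta eta hb heta) as [e [he hQ]].
  set (s := / beta * / (beta - 1)).
  assert (hs : beta * s = / (beta - 1)) by (unfold s; field; lra).
  assert (hM : beta * / (beta - 1) = 1 + / (beta - 1)) by (field; lra).
  assert (hM0 : 0 < / (beta - 1)) by (apply Rinv_0_lt_compat; lra).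
  assert (hMb : / (beta - 1) < beta) by nra.
  assert (hs1 : s < 1) by nra.
  split.
  - intros hSFT.
    assert (hlow : exists i, tail_value beta e i <= / (beta - 1) - 1).
    { apply NNPP; intros hno; apply (not_is_SFT_Utilde beta e hb he); [| exact hSFT].
      intros i; apply Rnot_le_lt; intros hle; apply hno; exists i; exact hle. }
    (* Go back from the low tail: before a 0 the value is lower still, and before a 1 it lies in the
       required interval. Index 0 is excluded because its value 1 is too large. *)
    assert (hk : exists k, (1 <= k)%nat /\ / beta < tail_value beta e k <= s).
    { destruct hlow as [i hi]; induction i as [|i IH].
      - destruct he; lra.
      - pose proof (tail_value_step beta e i ltac:(lra)) as hst.
        pose proof (proj2 he i).
        destruct (e i) eqn:hei; simpl in hst.
        + exists i; split.
          * destruct i; [destruct he; nra | lia].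
          * split; [apply (quasi_greedy_bit_iff beta); try assumption; lra | nra].
        + apply IH; nra. }
    destruct hk as [k [hk1 hk]].
    destruct (first_entrance beta s e k ltac:(lra) he hs1 hk1 hk) as [n [hn1 [hn hfirst]]].
    exists n; split; [assumption | split].
    + exists (tail_value beta e n); split; [apply hQ; reflexivity | exact hn].
    + intros i hi y hy; apply hQ in hy; rewrite hy; apply hfirst, hi.
  - intros [n [_ [[y [hy hreg]] _]]].
    apply hQ in hy; subst y.
    assert (hn : e n = true) by (apply (quasi_greedy_bit_iff beta); try assumption; lra).
    apply is_SFT_Utilde with e n; try assumption.
    pose proof (tail_value_step beta e n ltac:(lra)) as hst.
    rewrite hn in hst; simpl in hst; nra.
Qed.
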